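(* Let $X$ be an infinite-dimensional complex Banach space and $T\in L(X)$. Then $T$ belongs to the class $(B_e)$ if and only if $T$ belongs to the class $(gB_e)$; that is, $\sigma_e(T)=\sigma_b(T)$ if and only if $\sigma_{bf}(T)=\sigma_d(T)$.
   Context: $L(X)$ denotes the algebra of bounded linear operators on $X$. For $S\in L(X)$: $\mathcal N(S)$ is the kernel, $\mathcal R(S)$ the range, $\alpha(S)=\dim\mathcal N(S)$, $\beta(S)=\operatorname{codim}\mathcal R(S)$; the ascent is $p(S)=\inf\{n\in\mathbb N:\mathcal N(S^n)=\mathcal N(S^{n+1})\}$ and the descent is $q(S)=\inf\{n:\mathcal R(S^n)=\mathcal R(S^{n+1})\}$ (infimum of the empty set is $\infty$). $S$ is Fredholm if $\mathcal R(S)$ is closed and $\alpha(S),\beta(S)<\infty$; $S$ is Browder if it is Fredholm with finite ascent and descent. For $n\in\mathbb N$, $S_{[n]}$ denotes the restriction of $S$ to $\mathcal R(S^n)$; $S$ is B-Fredholm if for some $n$, $\mathcal R(S^n)$ is closed and $S_{[n]}:\mathcal R(S^n)\to\mathcal R(S^n)$ is Fredholm. The essential spectrum $\sigma_e(T)$, Browder spectrum $\sigma_b(T)$, and B-Fredholm spectrum $\sigma_{bf}(T)$ are the sets of $\lambda\in\mathbb C$ for which $T-\lambda I$ is not Fredholm, not Browder, not B-Fredholm, respectively. The Drazin spectrum is $\sigma_d(T)=\{\lambda\in\mathbb C: p(T-\lambda I)=\infty \text{ or } q(T-\lambda I)=\infty\}$. $\Pi(T)$ is the set of poles: $\lambda\in\sigma(T)$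 with $p(T-\lambda I),q(T-\lambda I)<\infty$; $\Pi^0(T)=\{\lambda\in\Pi(T):\alpha(T-\lambda I)<\infty\}$. $T\in(B_e)$ means $\sigma(T)\setminus\sigma_e(T)=\Pi^0(T)$, equivalently $\sigma_e(T)=\sigma_b(T)$; $T\in(gB_e)$ means $\sigma(T)\setminus\sigma_{bf}(T)=\Pi(T)$, equivalently $\sigma_{bf}(T)=\sigma_d(T)$. *)

(* Defs.v *)
From mathcomp Require Import all_boot all_algebra.
From mathcomp Require Export complex.
From mathcomp Require Export all_classical all_reals all_analysis.
Import numFieldNormedType.Exports.
Import GRing.Theory Num.Theory.
Set Implicit Arguments. Unset Strict Implicit. Unset Printing Implicit Defensive.
Local Open Scope ring_scope.
Local Open Scope classical_set_scope.

Section OperatorTheory.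
Variables (K : numFieldType) (X : normedModType K).

Definition linear_op (S : X -> X) : Prop :=
  forall (a : K) (x y : X), S (a *: x + y) = a *: S x + S y.
Definition bounded_op (S : X -> X) : Prop := linear_op S /\ continuous S.

Definition shift_op (T : X -> X) (l : K) : X -> X := fun x => T x - l *: x.

Definition kernel (S : X -> X) : set X := [set x | S x = 0].

Definition span_seq (s : seq X) : set X :=
  [set x | exists c : 'I_(size s) -> K, x = \sum_(i < size s) c i *: nth 0 s i].

Definition fin_dim (M : set X) : Prop := exists s : seq X, M `<=` span_seq s.

(* the subspace B has finite codimension in the subspace M (B `<=` M) *)
Definition fin_codim_in (B M : set X) : Prop :=
  exists s : seq X, M `<=` [set z | exists b y, B b /\ span_seq s y /\ z = b + y].

Definition fredholm (S : X -> X) : Prop :=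
  closed (range S) /\ fin_dim (kernel S) /\ fin_codim_in (range S) setT.

Definition finite_ascent (S : X -> X) : Prop :=
  exists n : nat, kernel (iter n S) = kernel (iter n.+1 S).
Definition finite_descent (S : X -> X) : Prop :=
  exists n : nat, range (iter n S) = range (iter n.+1 S).

Definition browder (S : X -> X) : Prop :=
  fredholm S /\ finite_ascent S /\ finite_descent S.

(* B-Fredholm: for some n, R(S^n) is closed and the restriction
   S_[n] : R(S^n) -> R(S^n) is Fredholm (written out on subsets of X) *)
Definition B_fredholm (S : X -> X) : Prop :=
  exists n : nat,
    let M := range (iter n S) in
    [/\ closed M,
        closed (S @` M),
        fin_dim (kernel S `&` M)
      & fin_codim_in (S @` M) M].

Definition invertible_op (S : X -> X) : Prop :=
  exists S' : X -> X, bounded_op S' /\ (forall x, S' (S x) = x) /\ (forall x, S (S' x) = x).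

Definition spectrum (T : X -> X) : set K := [set l | ~ invertible_op (shift_op T l)].
Definition ess_spectrum (T : X -> X) : set K := [set l | ~ fredholm (shift_op T l)].
Definition browder_spectrum (T : X -> X) : set K := [set l | ~ browder (shift_op T l)].
Definition bf_spectrum (T : X -> X) : set K := [set l | ~ B_fredholm (shift_op T l)].
Definition drazin_spectrum (T : X -> X) : set K :=
  [set l | ~ finite_ascent (shift_op T l) \/ ~ finite_descent (shift_op T l)].

Definition poles (T : X -> X) : set K :=
  [set l | spectrum T l /\ finite_ascent (shift_op T l) /\ finite_descent (shift_op T l)].
Definition poles0 (T : X -> X) : set K :=
  [set l | poles T l /\ fin_dim (kernel (shift_op T l))].

Definition class_Be (T : X -> X) : Prop := spectrum T `\` ess_spectrum T = poles0 T.
Definition class_gBe (T : X -> X) : Prop := spectrum T `\` bf_spectrum T = poles T.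

End OperatorTheory.

(* Main.v *)
Require Import Defs.
From mathcomp Require Import all_boot all_order all_algebra.
From mathcomp Require Import ssrAC complex ring lra.
From mathcomp Require Import all_classical all_reals all_analysis.
Import numFieldNormedType.Exports.
Import Order.TTheory GRing.Theory Num.Theory.
Local Open Scope ring_scope.
Local Open Scope classical_set_scope.
Set Implicit Arguments. Unset Strict Implicit. Unset Printing Implicit Defensive.

(** Write S = T - l.  If S has finite ascent and descent then X = N(S^p) (+) R(S^p) for
    some p, and the open mapping theorem makes R(S^p) closed; hence S is B-Fredholm, and
    Fredholm as soon as N(S) is finite-dimensional.

    Conversely let S be B-Fredholm.  For large m the ranges R(S^m) are closed and
    N(S) /\ R(S^m) is contained in the hyper-range H, the intersection of all R(S^k),
    which S maps onto itself.  For small a <> 0 the operator S - a is Fredholm: its kernel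
    is contained in H and is spanned by perturbed generators of N(S) /\ H, and
    X = R(S^m) + R(S - a).  Under (B_e) such an S - a has finite ascent and descent.
    A nonzero vector of N(S) /\ H would perturb to one of N(S - a) contained in every
    R((S - a)^k), so S has finite ascent; then S is bounded below on R(S^m), S - a is
    bijective there, and so is its small perturbation S. *)

(** * Real-valued norms, closed sets and bounded operators *)

Section RealNorm.
Variables (R : realType) (X : normedModType R[i]).
Implicit Types (x y z : X) (a : R[i]) (A : set X).

(* The norm of a [normedModType R[i]] takes its values in [R[i]]. *)
Definition nrm x : R := complex.Re `|x|.
Definition cabs a : R := complex.Re `|a|.

Lemma nrmE x : (nrm x)%:C%C = `|x|.
Proof. exact/RRe_real/normr_real. Qed.
Lemma cabsE a : (cabs a)%:C%C = `|a|.
Proof. exact/RRe_real/normr_real. Qed.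
Lemma nrm_ge0 x : 0 <= nrm x.
Proof. by rewrite -lecR nrmE normr_ge0. Qed.
Lemma cabs_ge0 a : 0 <= cabs a.
Proof. by rewrite -lecR cabsE normr_ge0. Qed.
Lemma nrm0 : nrm 0 = 0.
Proof. by rewrite /nrm normr0. Qed.
Lemma nrm_eq0 x : nrm x = 0 -> x = 0.
Proof. by move=> h; apply: normr0_eq0; rewrite -nrmE h. Qed.
Lemma nrm_gt0 x : x <> 0 -> 0 < nrm x.
Proof. by move=> /eqP x0; rewrite -ltcR nrmE normr_gt0. Qed.
Lemma nrmD x y : nrm (x + y) <= nrm x + nrm y.
Proof. by rewrite -lecR rmorphD /= !nrmE ler_normD. Qed.
Lemma nrmN x : nrm (- x) = nrm x.
Proof. by rewrite /nrm normrN. Qed.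
Lemma nrmB x y : nrm (x - y) <= nrm x + nrm y.
Proof. by rewrite -(nrmN y) nrmD. Qed.
Lemma nrmC x y : nrm (x - y) = nrm (y - x).
Proof. by rewrite -nrmN opprB. Qed.
Lemma nrm_triangle y x z : nrm (x - z) <= nrm (x - y) + nrm (y - z).
Proof. by rewrite -[x - z](subrKA y) nrmD. Qed.
Lemma nrmZ a x : nrm (a *: x) = cabs a * nrm x.
Proof. by apply: complexI; rewrite rmorphM /= !nrmE cabsE normrZ. Qed.
Lemma cabs_real (r : R) : 0 <= r -> cabs r%:C%C = r.
Proof. by move=> r0; rewrite /cabs ger0_norm// lecR. Qed.
Lemma cabsN a : cabs (- a) = cabs a.
Proof. by rewrite /cabs normrN. Qed.

Lemma nbhs_nrmP x (P : set X) :
  nbhs x P <-> exists2 e : R, 0 < e & forall y, nrm (x - y) < e -> P y.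
Proof.
split=> [/nbhs_normP [e /= e0 h]|[e e0 h]].
  exists (complex.Re e).
    by move: e0; rewrite ltcE => /andP[].
  move=> y hy; apply: h => /=; rewrite -nrmE.
  move: e0; rewrite !ltcE /= => /andP[/eqP -> _]; by rewrite eqxx.
apply/nbhs_normP; exists e%:C%C => /=; first by rewrite ltcR.
by move=> y /=; rewrite -nrmE ltcR => /h.
Qed.

Lemma closedP A :
  closed A <->
  forall x, (forall e : R, 0 < e -> exists2 y, A y & nrm (x - y) < e) -> A x.
Proof.
split=> [cA x h|h x cx].
  apply: cA => B /nbhs_nrmP[e e0 hB]; have [y Ay hy] := h e e0.
  by exists y; split=> //; apply: hB.
apply: h => e e0; have [|y [Ay hy]] := cx [set y | nrm (x - y) < e].
  by apply/nbhs_nrmP; exists e.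
by exists y.
Qed.

Lemma bounded_opP (S : X -> X) : bounded_op S ->
  exists2 C : R, 0 < C & forall x, nrm (S x) <= C * nrm x.
Proof.
move=> [lS cS].
have S0 : S 0 = 0.
  by have := lS (-1) 0 0; rewrite scaler0 addr0 scaleN1r addNr.
have SZ a x : S (a *: x) = a *: S x.
  by have := lS a x 0; rewrite !addr0 S0 addr0.
have /nbhs_nrmP[e e0 he] : nbhs (0:X) (S @^-1` [set y | nrm y < 1]).
  apply: cS; apply/nbhs_nrmP; exists 1 => // y.
  by rewrite S0 sub0r nrmN.
exists (2 / e); first by rewrite divr_gt0.
move=> x; have [->|x0] := eqVneq x 0; first by rewrite S0 nrm0 mulr0.
have nx : 0 < nrm x by apply/nrm_gt0/eqP.
(* Rescaling [x] to norm [e / 2] puts it inside the ball on which [S] is bounded by 1. *)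
set t : R := e / 2 / nrm x.
have t0 : 0 < t by rewrite !divr_gt0.
have := he (t%:C%C *: x); rewrite /= sub0r nrmN SZ !nrmZ cabs_real ?(ltW t0)//.
have -> : t * nrm x = e / 2 by rewrite divfK ?gt_eqF.
have he2 : e / 2 < e by rewrite ltr_pdivrMr// ltr_pMr// ltr1n.
move=> /(_ he2) h; have : nrm (S x) < t^-1 by rewrite -[ltRHS]mul1r ltr_pdivlMr// mulrC.
have -> : t^-1 = 2 / e * nrm x by rewrite /t; field; rewrite !gt_eqF.
exact: ltW.
Qed.
End RealNorm.

(** * Geometric convergence and the Baire category theorem *)

Section Series.
Variables (R : realType) (X : completeNormedModType R[i]).
Implicit Types (x y z : X) (a : R[i]) (A : set X).

Lemma half_expn_lt (c e : R) : 0 <= c -> 0 < e -> exists N : nat, c / 2 ^+ N < e.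
Proof.
move=> c0 e0; exists (Num.bound (c / e)).
rewrite ltr_pdivrMr ?exprn_gt0// -ltr_pdivrMl// mulrC.
apply: lt_trans (archi_boundP _) _; first by rewrite divr_ge0// ltW.
by rewrite -natrX ltr_nat ltn_expl.
Qed.

Lemma half_expnS (c : R) n : c / 2 ^+ n.+1 = c / 2 ^+ n / 2.
Proof. by rewrite exprSr invfM mulrA. Qed.

Lemma half_expn_le0 x (c : R) : 0 <= c -> (forall n, nrm x <= c / 2 ^+ n) -> x = 0.
Proof.
move=> c0 h; apply/nrm_eq0/eqP; rewrite eq_le nrm_ge0 andbT.
apply/ler_addgt0Pr => e e0; rewrite add0r; have [N /ltW hN] := half_expn_lt c0 e0.
exact: le_trans (h N) hN.
Qed.

Lemma geometric_steps (u : nat -> X) (c : R) :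
  (forall k, nrm (u k.+1 - u k) <= c / 2 ^+ k) ->
  exists l, forall n, nrm (l - u n) <= 2 * c / 2 ^+ n.
Proof.
move=> hu.
have c0 : 0 <= c by have := hu 0; rewrite expr0 divr1; apply: le_trans (nrm_ge0 _).
(* Subtracting the tail [2 * c / 2 ^+ (n + k)] lets the induction on [k] telescope. *)
have hd n k : nrm (u (n + k)%N - u n) <= 2 * c / 2 ^+ n - 2 * c / 2 ^+ (n + k).
  elim: k => [|k IH]; first by rewrite addn0 !subrr nrm0.
  apply: le_trans (nrm_triangle (u (n + k)%N) _ _) _.
  rewrite addnS; apply: le_trans (lerD (hu _) IH) _.
  rewrite [2 * c / 2 ^+ (n + k).+1]half_expnS; lra.
have hd' n m : (n <= m)%N -> nrm (u m - u n) <= 2 * c / 2 ^+ n.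
  move=> nm; have := hd n (m - n)%N; rewrite subnKC// => /le_trans; apply.
  by rewrite lerBlDr lerDl divr_ge0// ?mulr_ge0// exprn_ge0.
have /cauchy_cvgP/cvg_ex[l hl] : cauchy (u @ \oo).
  apply: cauchy_exP => e e0.
  have e0' : 0 < complex.Re e by move: e0; rewrite ltcE => /andP[].
  have eE : e = (complex.Re e)%:C%C by rewrite RRe_real// gtr0_real.
  have [N hN] := half_expn_lt (mulr_ge0 (ler0n _ 2) c0) e0'.
  exists (u N); exists N => // m /= Nm.
  rewrite -ball_normE /= eE -nrmE ltcR nrmC.
  exact: le_lt_trans (hd' _ _ Nm) hN.
exists l => n; apply/ler_addgt0Pr => e e0.
have [N _ hN] : \forall m \near \oo, nrm (l - u m) < e.
  by apply: (hl [set y | nrm (l - y) < e]); apply/nbhs_nrmP; exists e.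
have mN : (N <= maxn N n)%N by exact: leq_maxl.
apply: le_trans (nrm_triangle (u (maxn N n)) _ _) _.
rewrite addrC; apply: lerD; first exact/hd'/leq_maxr.
exact/ltW/hN.
Qed.

Lemma geometric_sum (x : nat -> X) (c : R) :
  (forall k, nrm (x k) <= c / 2 ^+ k) ->
  exists l, forall n, nrm (l - \sum_(k < n) x k) <= 2 * c / 2 ^+ n.
Proof.
move=> hx; apply: (geometric_steps (u := fun n => \sum_(k < n) x k)) => k.
by rewrite big_ord_recr /= addrAC subrr add0r.
Qed.

(** If no [D k] were dense in a relative ball of [Y], one could choose shrinking balls, the one
    chosen at stage [k] keeping clear of [D k]; the limit of the centres would lie in [Y] but in no
    [D k]. *)
Lemma baire_closed (Y : set X) (D : nat -> set X) y0 :
  closed Y -> Y y0 -> Y `<=` \bigcup_k D k ->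
  exists k y (r : R), [/\ Y y, 0 < r &
    forall z, Y z -> nrm (y - z) < r ->
    forall e : R, 0 < e -> exists2 d, D k d & nrm (z - d) < e].
Proof.
move=> /closedP cY Yy0 YD; apply: contrapT => H.
have step (k : nat) (p : X * R) : exists q : X * R,
  Y p.1 -> 0 < p.2 -> [/\ Y q.1, 0 < q.2, q.2 <= p.2 / 2,
    nrm (q.1 - p.1) <= p.2 / 2 & forall d, D k d -> q.2 < nrm (q.1 - d)].
  (* A state [p] is a centre with a radius. States violating the premises are returned unchanged, so
     that [choice] can be applied to all states. *)
  have [[Yp p0]|h] := pselect (Y p.1 /\ 0 < p.2); last first.
    by exists p => ? ?; case: h.
  apply: contrapT => Hq; apply: H; exists k, p.1, (p.2 / 2); split=> //.
    by rewrite divr_gt0.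
  move=> z Yz hz e e0; apply: contrapT => hd; apply: Hq.
  exists (z, Num.min (p.2 / 2) (e / 2)) => _ _; split => //=.
  - by rewrite lt_min !divr_gt0.
  - by rewrite ge_min lexx.
  - by rewrite nrmC ltW.
  move=> d Dd; rewrite gt_min; apply/orP; right; rewrite ltNge; apply/negP => h.
  by apply: hd; exists d => //; apply: le_lt_trans h _; lra.
have [f hf] := choice (fun kp : nat * (X * R) => step kp.1 kp.2).
pose v := fix v n := if n is m.+1 then f (m, v m) else (y0, 1%R).
have hv n : Y (v n).1 /\ 0 < (v n).2.
  elim: n => [|n [h1 h2]] /=; first by [].
  by have [] := hf (n, v n) h1 h2.
have hv2 n : [/\ (v n.+1).2 <= (v n).2 / 2, nrm ((v n.+1).1 - (v n).1) <= (v n).2 / 2 &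
   forall d, D n d -> (v n.+1).2 < nrm ((v n.+1).1 - d)].
  by have [h1 h2] := hv n; have [] := hf (n, v n) h1 h2.
have hr n m : (v (n + m)%N).2 <= (v n).2 / 2 ^+ m.
  elim: m => [|m IH]; first by rewrite addn0 expr0 divr1.
  rewrite addnS half_expnS; have [h _ _] := hv2 (n + m)%N; apply: le_trans h _.
  by rewrite ler_pM2r// invr_gt0.
have hlim n : exists l, forall m, nrm (l - (v (n + m)%N).1) <= 2 * ((v n).2 / 2) / 2 ^+ m.
  apply: (geometric_steps (u := fun m => (v (n + m)%N).1)) => k; rewrite addnS.
  have [_ h _] := hv2 (n + k)%N; apply: le_trans h _.
  by rewrite mulrAC ler_pM2r ?invr_gt0.
have [l hl] := hlim 0; rewrite /= in hl.
have Yl : Y l.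
  apply: cY => e e0; have c0 : 0 <= 2 * (1 / 2) :> R by lra.
  have [N hN] := half_expn_lt c0 e0.
  by exists (v N).1; [case: (hv N)|apply: le_lt_trans (hl N) hN].
have [k _ Dl] := YD _ Yl.
have [_ _ /(_ _ Dl)] := hv2 k; apply/negP; rewrite -leNgt nrmC.
(* Restarting the same limit at [k.+1] gives the sharp bound [(v k.+1).2] on its distance to the
   centre, which contradicts the gap between that centre and [D k]. *)
have [l' hl'] := hlim k.+1.
suff -> : l = l'.
  by have := hl' 0; rewrite addn0 expr0 divr1 => /le_trans; apply; lra.
apply/eqP; rewrite -subr_eq0; apply/eqP.
have r0 := (hv k.+1).2; apply: (half_expn_le0 (c := 1 + (v k.+1).2)); first lra.
move=> m; apply: le_trans (nrm_triangle (v (k.+1 + m)%N).1 _ _) _.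
rewrite mulrDl; apply: lerD; last by rewrite nrmC; have := hl' m; rewrite [2 * _]mulrC divfK.
have := hl (k.+1 + m)%N; rewrite add0n => /le_trans; apply.
rewrite [2 * _]mulrC divfK// !div1r lef_pV2 ?posrE ?exprn_gt0//.
by rewrite ler_eXn2l ?ltr1n// leq_addl.
Qed.
End Series.

(** * Subspaces, bounded operators and the open mapping theorem *)

Section Operators.
Variables (R : realType) (X : completeNormedModType R[i]).
Implicit Types (x y z : X) (a : R[i]) (M F Y V : set X) (B S : X -> X).

Definition lin_subspace V :=
  V 0 /\ forall a x y, V x -> V y -> V (a *: x + y).

Definition nrm_bounded B :=
  linear_op B /\ exists2 K : R, 0 < K & forall x, nrm (B x) <= K * nrm x.

(** Quantitative openness of [(x, f) |-> B x + f] from [M] times [F], covering [Y]. The summand [F]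
    plays the role of a complement of the image of [M]; with [F] reduced to 0 the equation [B x = z]
    itself is solved with control. *)
Definition open_onto B M F Y (c : R) := forall z, Y z ->
  exists x f, [/\ M x, F f, z = B x + f, nrm x <= c * nrm z & nrm f <= c * nrm z].

Lemma subspaceD V x y : lin_subspace V -> V x -> V y -> V (x + y).
Proof. by move=> [_ h] Vx Vy; rewrite -[x]scale1r; apply: h. Qed.
Lemma subspaceZ V a x : lin_subspace V -> V x -> V (a *: x).
Proof. by move=> [V0 h] Vx; rewrite -[_ *: _]addr0; apply: h. Qed.
Lemma subspaceN V x : lin_subspace V -> V x -> V (- x).
Proof. by move=> sV Vx; rewrite -scaleN1r; apply: subspaceZ. Qed.
Lemma subspaceB V x y : lin_subspace V -> V x -> V y -> V (x - y).
Proof. by move=> sV Vx Vy; apply: subspaceD => //; apply: subspaceN. Qed.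
Lemma subspace_sum V (I : Type) (r : seq I) (P : pred I) (u : I -> X) :
  lin_subspace V -> (forall i, P i -> V (u i)) -> V (\sum_(i <- r | P i) u i).
Proof.
move=> sV h; apply: (big_ind V) => //; first by case: sV.
by move=> x y Vx Vy; apply: subspaceD.
Qed.
Lemma subspace1 : lin_subspace [set 0 : X].
Proof. by split=> // a x y /= -> ->; rewrite scaler0 addr0. Qed.
Lemma subspaceI V M : lin_subspace V -> lin_subspace M -> lin_subspace (V `&` M).
Proof.
by move=> [V0 hV] [M0 hM]; split=> // a x y [? ?] [? ?]; split; [apply: hV|apply: hM].
Qed.

Lemma linop0 B : linear_op B -> B 0 = 0.
Proof. by move=> lB; have := lB (-1) 0 0; rewrite scaler0 addr0 scaleN1r addNr. Qed.
Lemma linopD B : linear_op B -> {morph B : x y / x + y}.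
Proof. by move=> lB x y; rewrite -[x]scale1r lB !scale1r. Qed.
Lemma linopZ B : linear_op B -> forall a x, B (a *: x) = a *: B x.
Proof. by move=> lB a x; rewrite -[a *: x]addr0 lB (linop0 lB) addr0. Qed.
Lemma linopB B : linear_op B -> {morph B : x y / x - y}.
Proof. by move=> lB x y; rewrite -scaleN1r (linopD lB) (linopZ lB) scaleN1r. Qed.

Lemma linop_iter B n : linear_op B -> linear_op (iter n B).
Proof.
by move=> lB; elim: n => [|n IH] a x y //=; rewrite IH lB.
Qed.
Lemma linop_shift B a : linear_op B -> linear_op (shift_op B a).
Proof.
move=> lB b x y; rewrite /shift_op lB scalerDr scalerA mulrC -scalerA.
by rewrite scalerBr opprD addrACA.
Qed.

Lemma subspace_range B M : linear_op B -> lin_subspace M -> lin_subspace (B @` M).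
Proof.
move=> lB [M0 hM]; split; first by exists 0 => //; apply: linop0.
by move=> a _ _ [x Mx <-] [y My <-]; exists (a *: x + y); [apply: hM|apply: lB].
Qed.
Lemma subspace_kernel B : linear_op B -> lin_subspace (Defs.kernel B).
Proof.
move=> lB; split; first exact: linop0.
by move=> a x y; rewrite /Defs.kernel /= lB => -> ->; rewrite scaler0 addr0.
Qed.

Lemma bounded_op_nrm S : bounded_op S -> nrm_bounded S.
Proof. by move=> bS; split; [case: bS|apply: bounded_opP]. Qed.

Lemma nrm_bounded_iter B n : nrm_bounded B -> nrm_bounded (iter n B).
Proof.
move=> [lB [K K0 hK]]; split; first exact: linop_iter.
elim: n => [|n [K' K'0 IH]]; first by exists 1 => // x; rewrite mul1r.
exists (K * K'); first exact: mulr_gt0.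
move=> x /=; apply: le_trans (hK _) _; rewrite -mulrA ler_pM2l//.
Qed.

Lemma nrm_bounded_shift B a : nrm_bounded B -> nrm_bounded (shift_op B a).
Proof.
move=> [lB [K K0 hK]]; split; first exact: linop_shift.
exists (K + cabs a); first by rewrite ltr_wpDr// cabs_ge0.
move=> x; apply: le_trans (nrmB _ _) _; rewrite nrmZ mulrDl.
by rewrite lerD2r.
Qed.

Lemma closed_kernel B : nrm_bounded B -> closed (Defs.kernel B).
Proof.
move=> [lB [K K0 hK]]; apply/closedP => x h.
apply/nrm_eq0/eqP; rewrite eq_le nrm_ge0 andbT.
apply/ler_addgt0Pr => e e0; rewrite add0r.
have [y By0 hy] := h (e / K) (divr_gt0 e0 K0).
have -> : B x = B (x - y) by rewrite (linopB lB) By0 subr0.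
by apply: le_trans (hK _) _; rewrite mulrC -ler_pdivlMr// ltW.
Qed.

Lemma closed_origin : closed [set 0 : X].
Proof.
apply/closedP => x h; apply/nrm_eq0/eqP; rewrite eq_le nrm_ge0 andbT.
apply/ler_addgt0Pr => e e0; rewrite add0r.
by have [y /= -> ] := h e e0; rewrite subr0 => /ltW.
Qed.

(* Successive approximation: it suffices to solve up to half of the datum. *)
Lemma open_onto_approx B M F Y (c : R) :
  nrm_bounded B -> lin_subspace M -> closed M -> lin_subspace F -> closed F -> 0 <= c ->
  (forall z, Y z -> exists x f,
    [/\ M x, F f, nrm x <= c * nrm z, nrm f <= c * nrm z &
        Y (z - (B x + f)) /\ nrm (z - (B x + f)) <= nrm z / 2]) ->
  open_onto B M F Y (2 * c).
Proof.
move=> [lB [K K0 hK]] sM /closedP cM sF /closedP cF c0 H.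
have H' z : exists p : X * X, Y z ->
    [/\ M p.1, F p.2, nrm p.1 <= c * nrm z, nrm p.2 <= c * nrm z &
        Y (z - (B p.1 + p.2)) /\ nrm (z - (B p.1 + p.2)) <= nrm z / 2].
  have [Yz|nYz] := pselect (Y z); last by exists (0, 0).
  by have [x [f hxf]] := H z Yz; exists (x, f).
have [g hg] := choice H'.
move=> z Yz; pose w k := iter k (fun u => u - (B (g u).1 + (g u).2)) z.
have hw k : Y (w k) /\ nrm (w k) <= nrm z / 2 ^+ k.
  elim: k => [|k [Yw hwk]]; first by rewrite expr0 divr1.
  have [_ _ _ _ [h1 h2]] := hg _ Yw; split=> //.
  by apply: le_trans h2 _; rewrite half_expnS ler_pM2r// invr_gt0.
have Pw k := hg _ (hw k).1.
have hx k : nrm (g (w k)).1 <= c * nrm z / 2 ^+ k.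
  have [_ _ h _ _] := Pw k; apply: le_trans h _.
  by rewrite -mulrA ler_wpM2l//; have [] := hw k.
have hf k : nrm (g (w k)).2 <= c * nrm z / 2 ^+ k.
  have [_ _ _ h _] := Pw k; apply: le_trans h _.
  by rewrite -mulrA ler_wpM2l//; have [] := hw k.
have [x hxl] := geometric_sum hx; have [f hfl] := geometric_sum hf.
have c1 : 0 <= 2 * (c * nrm z) by rewrite !mulr_ge0// nrm_ge0.
exists x, f; split.
- apply: cM => e e0; have [N hN] := half_expn_lt c1 e0.
  exists (\sum_(k < N) (g (w k)).1); last exact: le_lt_trans (hxl N) hN.
  by apply: subspace_sum => // k _; have [] := Pw k.
- apply: cF => e e0; have [N hN] := half_expn_lt c1 e0.
  exists (\sum_(k < N) (g (w k)).2); last exact: le_lt_trans (hfl N) hN.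
  by apply: subspace_sum => // k _; have [] := Pw k.
(* The residual [w n] and the tails of both series all decay like [1 / 2 ^+ n]. *)
- have hz n : z = w n + (B (\sum_(k < n) (g (w k)).1) + \sum_(k < n) (g (w k)).2).
    elim: n => [|n {1}->]; first by rewrite !big_ord0 (linop0 lB) addr0 [RHS]addr0.
    rewrite !big_ord_recr /= (linopD lB) -/(w n).
    by rewrite [X in _ = _ + X]addrACA [X in _ = _ + X]addrC subrKA.
  apply/eqP; rewrite -subr_eq0; apply/eqP.
  apply: (half_expn_le0 (c := nrm z + (K * (2 * (c * nrm z)) + 2 * (c * nrm z)))).
    by rewrite !addr_ge0 ?nrm_ge0// mulr_ge0// ltW.
  move=> n; rewrite {1}(hz n).
  set sx := \sum_(k < n) (g (w k)).1; set sf := \sum_(k < n) (g (w k)).2.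
  have -> : w n + (B sx + sf) - (B x + f) = w n - (B (x - sx) + (f - sf)).
    by rewrite (linopB lB) !opprD !opprK !addrA [LHS](ACl (1*4*2*5*3)).
  apply: le_trans (nrmB _ _) _; rewrite mulrDl; apply: lerD.
    by have [] := hw n.
  apply: le_trans (nrmD _ _) _; rewrite mulrDl; apply: lerD; last exact: hfl.
  by apply: le_trans (hK _) _; rewrite -mulrA ler_pM2l//; apply: hxl.
- by have := hxl 0; rewrite big_ord0 subr0 expr0 divr1 mulrA.
- by have := hfl 0; rewrite big_ord0 subr0 expr0 divr1 mulrA.
Qed.

(** By Baire, the values in [Y] taken at pairs of norm at most [k] are dense in some ball about some
    [y]. Approximating both [y + t z] and [y] and subtracting solves the equation for [z] up to half
    of its norm, and successive approximation does the rest. *)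
Lemma open_mapping B M F Y :
  nrm_bounded B -> lin_subspace M -> closed M -> lin_subspace F -> closed F ->
  lin_subspace Y -> closed Y ->
  (forall z, Y z -> exists x f, [/\ M x, F f & z = B x + f]) ->
  exists2 c : R, 0 < c & open_onto B M F Y c.
Proof.
move=> bB sM cM sF cF sY cY H; have lB := bB.1.
pose D (k : nat) := [set z | Y z /\ exists x f,
  [/\ M x, F f, z = B x + f, nrm x <= k%:R & nrm f <= k%:R]].
have YD : Y `<=` \bigcup_k D k.
  move=> z Yz; have [x [f [Mx Ff zE]]] := H z Yz.
  exists (Num.bound (nrm x + nrm f)) => //; split=> //; exists x, f; split=> //.
    apply: le_trans (ltW (archi_boundP _)); first by rewrite lerDl nrm_ge0.
    by rewrite addr_ge0// nrm_ge0.
  apply: le_trans (ltW (archi_boundP _)); first by rewrite lerDr nrm_ge0.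
  by rewrite addr_ge0// nrm_ge0.
have [k [y [r [Yy r0 hD]]]] := baire_closed cY sY.1 YD.
(* Two approximants differ by at most [2 k] in each component; division by [t = r / (2 |z|)] turns
   this into [4 k / r] times [|z|]. *)
pose C : R := 4 * k%:R / r.
have C0 : 0 <= C by rewrite divr_ge0 ?mulr_ge0// ltW.
suff hop : open_onto B M F Y (2 * C).
  (* [C] vanishes when [k = 0]; adding 1 makes the constant positive. *)
  exists (2 * C + 1) => [|z Yz]; first lra.
  have [x [f [? ? ? hx hf]]] := hop z Yz; exists x, f; have := nrm_ge0 z.
  by split=> //; lra.
apply: open_onto_approx => // z Yz.
have [->|z0] := eqVneq z 0.
  exists 0, 0; rewrite (linop0 lB) addr0 subr0 !nrm0 mulr0 mul0r.
  by have [? _] := sY; have [? _] := sM; have [? _] := sF.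
have nz : 0 < nrm z by apply/nrm_gt0/eqP.
(* The point [y + t z] lies at distance [r / 2] from [y], inside the ball. Two errors below [r / 8]
   add up to at most [r / 4], which becomes [|z| / 2] after division by [t]. *)
pose t : R := r / 2 / nrm z.
have t0 : 0 < t by rewrite !divr_gt0.
have tz : t * nrm z = r / 2 by rewrite /t divfK// gt_eqF.
have r8 : 0 < r / 8 by rewrite divr_gt0.
have [||d1 [Yd1 [x1 [f1 [Mx1 Ff1 E1 hx1 hf1]]]] h1] := hD (y + t%:C%C *: z) _ _ _ r8.
- by apply: subspaceD => //; apply: subspaceZ.
- by rewrite opprD addNKr nrmN nrmZ cabs_real ?(ltW t0)// tz; lra.
have [||d2 [Yd2 [x2 [f2 [Mx2 Ff2 E2 hx2 hf2]]]] h2] := hD y _ _ _ r8.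
- by [].
- by rewrite subrr nrm0.
have tC0 : t%:C%C != 0 by apply/eqP => /complexI /eqP; rewrite gt_eqF.
have ti : cabs (t%:C%C)^-1 = t^-1.
  by rewrite -fmorphV cabs_real// invr_ge0 ltW.
have tiE : t^-1 = 2 / r * nrm z by rewrite /t; field; rewrite !gt_eqF.
have zE : z - (B ((t%:C%C)^-1 *: (x1 - x2)) + (t%:C%C)^-1 *: (f1 - f2)) =
    (t%:C%C)^-1 *: ((y + t%:C%C *: z - d1) - (y - d2)).
  rewrite (linopZ lB) (linopB lB) -scalerDr addrACA -opprD -E1 -E2.
  have -> : y + t%:C%C *: z - d1 - (y - d2) = t%:C%C *: z - (d1 - d2).
    by rewrite !opprB !addrA [LHS](ACl (2*4*3*(1*5))) /= subrr addr0.
  by rewrite [RHS]scalerBr scalerA mulVf// scale1r.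
exists ((t%:C%C)^-1 *: (x1 - x2)), ((t%:C%C)^-1 *: (f1 - f2)); split.
- by apply: subspaceZ => //; apply: subspaceB.
- by apply: subspaceZ => //; apply: subspaceB.
- rewrite nrmZ ti; have := nrmB x1 x2; rewrite tiE => h.
  rewrite -subr_ge0; have -> : C * nrm z - 2 / r * nrm z * nrm (x1 - x2) =
    2 / r * nrm z * (2 * k%:R - nrm (x1 - x2)) by rewrite /C; field; rewrite gt_eqF.
  by rewrite mulr_ge0 ?divr_ge0 ?mulr_ge0 ?nrm_ge0 ?invr_ge0 ?(ltW r0)//; lra.
- rewrite nrmZ ti; have := nrmB f1 f2; rewrite tiE => h.
  rewrite -subr_ge0; have -> : C * nrm z - 2 / r * nrm z * nrm (f1 - f2) =
    2 / r * nrm z * (2 * k%:R - nrm (f1 - f2)) by rewrite /C; field; rewrite gt_eqF.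
  by rewrite mulr_ge0 ?divr_ge0 ?mulr_ge0 ?nrm_ge0 ?invr_ge0 ?(ltW r0)//; lra.
rewrite zE; split.
  apply: subspaceZ => //; apply: subspaceB => //; apply: subspaceB => //.
  by apply: subspaceD => //; apply: subspaceZ.
rewrite nrmZ ti tiE.
set n := nrm (_ - _ - _); have hn : n <= r / 4.
  by apply: le_trans (nrmB _ _) _; lra.
rewrite -subr_ge0; have -> : nrm z / 2 - 2 / r * nrm z * n =
    2 / r * nrm z * (r / 4 - n) by field; rewrite gt_eqF.
by rewrite mulr_ge0 ?subr_ge0// mulr_ge0 ?nrm_ge0 ?divr_ge0// ltW.
Qed.

(** A solution for [S] leaves the residual [a *: x] for [S - a]; the inclusion of [M] in [Y] keeps
    it in [Y], and the smallness of [a] makes it at most half of the datum. *)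
Lemma open_onto_shift S M F Y (c : R) a :
  nrm_bounded S -> lin_subspace M -> closed M -> lin_subspace F -> closed F ->
  lin_subspace Y -> M `<=` Y -> 0 <= c -> cabs a * c <= 1 / 2 ->
  open_onto S M F Y c -> open_onto (shift_op S a) M F Y (2 * c).
Proof.
move=> bS sM cM sF cF sY MY c0 hc H; apply: open_onto_approx => //.
  exact: nrm_bounded_shift.
move=> z Yz; have [x [f [Mx Ff zE hx hf]]] := H z Yz; exists x, f.
have -> : z - (shift_op S a x + f) = a *: x.
  by rewrite /shift_op zE !opprD opprK !addrA [LHS](ACl (1*3*(2*5)*4)) /= !subrr !add0r.
split=> //; split; first by apply: subspaceZ => //; apply: MY.
rewrite nrmZ; apply: le_trans (ler_wpM2l (cabs_ge0 a) hx) _.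
by rewrite mulrA [nrm z / 2]mulrC -div1r ler_wpM2r// nrm_ge0.
Qed.

(** If [B x'] is close to [z = B x + f], openness writes [z - B x'] as [B x2 + f2] with [f2] small.
    Since [F] meets the image of [M] only in 0, [f = f2]; hence [f] is arbitrarily small and [z] is
    in the image. *)
Lemma closed_image B M F Y :
  nrm_bounded B -> lin_subspace M -> closed M -> lin_subspace F -> closed F ->
  lin_subspace Y -> closed Y -> B @` M `<=` Y ->
  (forall z, Y z -> exists x f, [/\ M x, F f & z = B x + f]) ->
  (forall x, M x -> F (B x) -> B x = 0) ->
  closed (B @` M).
Proof.
move=> bB sM cM sF cF sY cY BMY H dir; have lB := bB.1.
have [c c0 hc] := open_mapping bB sM cM sF cF sY cY H.
apply/closedP => z hz.
have Yz : Y z.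
  move/closedP: cY; apply=> e /hz [_ [x Mx <-] h]; exists (B x) => //.
  by apply: BMY; exists x.
have [x [f [Mx Ff zE]]] := H z Yz.
suff f0 : f = 0 by exists x => //; rewrite zE f0 addr0.
apply/nrm_eq0/eqP; rewrite eq_le nrm_ge0 andbT.
apply/ler_addgt0Pr => e e0; rewrite add0r.
have [_ [x' Mx' <-] hx'] := hz (e / c) (divr_gt0 e0 c0).
have [|x2 [f2 [Mx2 Ff2 E _ hf2]]] := hc (z - B x').
  by apply: subspaceB => //; apply: BMY; exists x'.
suff -> : f = f2 by apply: le_trans hf2 _; rewrite mulrC -ler_pdivlMr// ltW.
have hB : B (x - x' - x2) = f2 - f.
  have Bx2 : B x2 = z - B x' - f2 by rewrite E addrK.
  have Bx : B x = z - f by rewrite zE addrK.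
  rewrite !(linopB lB) Bx2 Bx !opprB !addrA.
  by rewrite [LHS](ACl (4*2*((1*6)*(3*5)))) /= subrr addNr !addr0.
have h0 : B (x - x' - x2) = 0.
  apply: dir; first by do !apply: subspaceB => //.
  by rewrite hB; apply: subspaceB.
by apply/eqP; rewrite eq_sym -subr_eq0 -hB h0.
Qed.
End Operators.

(** * Finite-dimensional subspaces and finite codimension *)

Section FiniteDimension.
Variables (R : realType) (X : completeNormedModType R[i]).
Implicit Types (x y z v : X) (a : R[i]) (M F Y V : set X) (B S : X -> X) (s t : seq X).

Lemma span_nilE : @span_seq _ X [::] = [set 0].
Proof.
apply/seteqP; split=> x /=; first by move=> [c ->]; rewrite big_ord0.
by move=> ->; exists (fun=> 0); rewrite big_ord0.
Qed.

Lemma span_consP v s x :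
  span_seq (v :: s) x <-> exists a y, span_seq s y /\ x = a *: v + y.
Proof.
split=> [[c ->]|[a [_ [[c ->] ->]]]].
  rewrite big_ord_recl /=; exists (c ord0), (\sum_(i < size s) c (lift ord0 i) *: s`_i).
  by split=> //; exists (fun i => c (lift ord0 i)).
exists (fun i : 'I_(size s).+1 => oapp c a (unlift ord0 i)).
rewrite big_ord_recl /= unlift_none /=; congr (_ + _).
by apply: eq_bigr => i _; rewrite liftK.
Qed.

Lemma subspace_span s : lin_subspace (span_seq s).
Proof.
elim: s => [|v s [IH0 IH]]; first by rewrite span_nilE; apply: subspace1.
split; first by apply/span_consP; exists 0, 0; rewrite scale0r addr0.
move=> a x y /span_consP[b [x' [hx ->]]] /span_consP[c [y' [hy ->]]].
apply/span_consP; exists (a * b + c), (a *: x' + y'); split; first exact: IH.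
by rewrite scalerDr addrACA scalerA scalerDl.
Qed.

Lemma span_seq_sub s V : lin_subspace V -> (forall x, x \in s -> V x) -> span_seq s `<=` V.
Proof.
move=> sV; elim: s => [|v s IH] h; first by rewrite span_nilE => _ ->; case: sV.
move=> _ /span_consP[a [y [hy ->]]]; apply: sV.2; first by apply: h; rewrite mem_head.
by apply: IH => // x xs; apply: h; rewrite inE xs orbT.
Qed.

Lemma mem_span s v : v \in s -> span_seq s v.
Proof.
elim: s => // w s IH; rewrite inE => /orP[/eqP ->|/IH h]; apply/span_consP.
  by exists 1, 0; rewrite scale1r addr0; split=> //; case: (subspace_span s).
by exists 0, v; rewrite scale0r add0r.
Qed.

Lemma span_catl s t : span_seq s `<=` span_seq (s ++ t).
Proof.
by apply: span_seq_sub => [|x xs]; [apply: subspace_span|apply: mem_span; rewrite mem_cat xs].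
Qed.
Lemma span_catr s t : span_seq t `<=` span_seq (s ++ t).
Proof.
by apply: span_seq_sub => [|x xs]; [apply: subspace_span|apply: mem_span; rewrite mem_cat xs orbT].
Qed.

Lemma far_from_closed V v : closed V -> ~ V v ->
  exists2 d : R, 0 < d & forall x, V x -> d <= nrm (v - x).
Proof.
move=> /closedP cV nV; apply: contrapT => H; apply: nV; apply: cV => e e0.
apply: contrapT => h; apply: H; exists e => // x Vx.
by rewrite leNgt; apply/negP => hx; apply: h; exists x.
Qed.

(** After factoring out [a], the vector is [v] minus an element of [V]. Thus the norm controls the
    coefficient of [v] once [v] has positive distance from [V]. *)
Lemma far_coef V v (d : R) : lin_subspace V ->
  (forall x, V x -> d <= nrm (v - x)) -> forall a y, V y -> cabs a * d <= nrm (a *: v + y).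
Proof.
move=> sV h a y Vy; have [->|a0] := eqVneq a 0.
  by rewrite /cabs normr0 mul0r nrm_ge0.
have -> : a *: v + y = a *: (v - (- a^-1 *: y)).
  by rewrite scalerBr scalerA mulrN divff// scaleN1r opprK.
by rewrite nrmZ ler_wpM2l ?cabs_ge0//; apply: h; apply: subspaceZ.
Qed.

(** The intervals of radius [2 * c / 2 ^+ n] about [r n] meet pairwise, so the supremum of their
    left ends lies in all of them. *)
Lemma real_geometric_steps (r : nat -> R) (c : R) :
  (forall k, `|r k.+1 - r k| <= c / 2 ^+ k) ->
  exists l, forall n, `|l - r n| <= 2 * c / 2 ^+ n.
Proof.
move=> hr.
have c0 : 0 <= c by have := hr 0; rewrite expr0 divr1; apply: le_trans.
pose e n : R := 2 * c / 2 ^+ n.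
have e0 n : 0 <= e n by rewrite divr_ge0 ?mulr_ge0// exprn_ge0.
have eS n : e n.+1 = e n / 2 by exact: half_expnS.
have hd n k : `|r (n + k)%N - r n| <= e n - e (n + k)%N.
  elim: k => [|k IH]; first by rewrite addn0 !subrr normr0.
  apply: le_trans (ler_distD (r (n + k)%N) _ _) _; rewrite addnS.
  apply: le_trans (lerD (hr _) IH) _; rewrite eS.
  have -> : c / 2 ^+ (n + k) = e (n + k)%N / 2 by rewrite /e; field; rewrite expf_neq0.
  lra.
have hnm n m : r n - e n <= r m + e m.
  have [nm|/ltnW mn] := leqP n m.
    have := hd n (m - n)%N; rewrite subnKC// ler_norml => /andP[h _].
    have := e0 m; lra.
  have := hd m (n - m)%N; rewrite subnKC// ler_norml => /andP[_ h].
  have := e0 n; lra.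
pose E := [set r n - e n | n in setT].
exists (sup E) => n; rewrite ler_norml; apply/andP; split.
  suff : r n - e n <= sup E by rewrite -/(e n); lra.
  apply: ub_le_sup; last by exists n.
  by exists (r 0 + e 0) => _ [k _ <-].
suff : sup E <= r n + e n by rewrite -/(e n); lra.
apply: ge_sup; first by exists (r 0 - e 0), 0.
by move=> _ [k _ <-].
Qed.

Lemma complex_geometric_steps (a : nat -> R[i]) (c : R) :
  (forall k, cabs (a k.+1 - a k) <= c / 2 ^+ k) ->
  exists l, forall n, cabs (l - a n) <= 4 * c / 2 ^+ n.
Proof.
move=> ha.
have hRe (u : R[i]) : `|complex.Re u| <= cabs u.
  by rewrite /cabs normc_def /= -sqrtr_sqr ler_wsqrtr// lerDl sqr_ge0.
have hIm (u : R[i]) : `|complex.Im u| <= cabs u.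
  by rewrite /cabs normc_def /= -sqrtr_sqr ler_wsqrtr// lerDr sqr_ge0.
have hC (u : R[i]) : cabs u <= `|complex.Re u| + `|complex.Im u|.
  rewrite /cabs normc_def /= -[leRHS]ger0_norm ?addr_ge0// -sqrtr_sqr ler_wsqrtr//.
  rewrite sqrrD -(real_normK (num_real (complex.Re u))) -(real_normK (num_real (complex.Im u))).
  by rewrite addrAC lerDl mulrn_wge0// mulr_ge0.
have ReB (u w : R[i]) : complex.Re (u - w) = complex.Re u - complex.Re w.
  by case: u; case: w.
have ImB (u w : R[i]) : complex.Im (u - w) = complex.Im u - complex.Im w.
  by case: u; case: w.
have [|p hp] := @real_geometric_steps (fun k => complex.Re (a k)) c.
  by move=> k; apply: le_trans (ha k); rewrite -ReB.
have [|q hq] := @real_geometric_steps (fun k => complex.Im (a k)) c.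
  by move=> k; apply: le_trans (ha k); rewrite -ImB.
exists (p +i* q)%C => n; apply: le_trans (hC _) _; rewrite ReB ImB /=.
apply: le_trans (lerD (hp n) (hq n)) _; lra.
Qed.

(** For [v] outside [V], the coefficients of [v] in suitable approximants of [x] change
    geometrically, hence converge to some [l]; then [x - l *: v] is a limit of elements of [V]. *)
Lemma closed_add_line V v : lin_subspace V -> closed V ->
  closed [set z | exists a y, V y /\ z = a *: v + y].
Proof.
move=> sV cV; have [Vv|nVv] := pselect (V v).
  suff -> : [set z | exists a y, V y /\ z = a *: v + y] = V by [].
  apply/seteqP; split=> [_ [a [y [Vy ->]]]|z Vz]; first exact: sV.2.
  by exists 0, z; rewrite scale0r add0r.
have [d d0 hd] := far_from_closed cV nVv.
apply/closedP => x hx.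
have H n : exists p : R[i] * X, V p.2 /\ nrm (x - (p.1 *: v + p.2)) < 1 / 2 ^+ n.
  have [|_ [a [y [Vy ->]]] h] := hx (1 / 2 ^+ n); first by rewrite divr_gt0// exprn_gt0.
  by exists (a, y).
have [p hp] := choice H.
pose u n := (p n).1 *: v + (p n).2.
have ha k : cabs ((p k.+1).1 - (p k).1) <= 2 / d / 2 ^+ k.
  have Vd : V ((p k.+1).2 - (p k).2).
    by apply: subspaceB => //; [case: (hp k.+1)|case: (hp k)].
  have := far_coef sV hd ((p k.+1).1 - (p k).1) Vd.
  have -> : ((p k.+1).1 - (p k).1) *: v + ((p k.+1).2 - (p k).2) = u k.+1 - u k.
    by rewrite scalerBl /u opprD addrACA.
  rewrite -ler_pdivlMr// => /le_trans; apply.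
  rewrite [2 / d / _]mulrAC ler_pM2r ?invr_gt0//.
  apply: le_trans (nrm_triangle x _ _) _; rewrite nrmC.
  have := (hp k).2; have := (hp k.+1).2; rewrite -/(u k) -/(u k.+1) half_expnS => h1 h2.
  have : 0 < 1 / 2 ^+ k :> R by rewrite divr_gt0// exprn_gt0.
  lra.
have [l hl] := complex_geometric_steps ha.
exists l, (x - l *: v); split; last by rewrite addrC subrK.
move/closedP: cV; apply=> e e0.
have c0 : 0 <= 1 + 4 * (2 / d) * nrm v.
  by rewrite addr_ge0// mulr_ge0 ?nrm_ge0// mulr_ge0// divr_ge0// ltW.
have [N hN] := half_expn_lt c0 e0; exists (p N).2; first by case: (hp N).
apply: le_lt_trans hN.
have -> : x - l *: v - (p N).2 = x - u N - (l - (p N).1) *: v.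
  by rewrite /u scalerBl !opprD opprK !addrA [RHS](ACl (1*4*3*(2*5))) /= addNr addr0.
apply: le_trans (nrmB _ _) _; rewrite mulrDl nrmZ; apply: lerD; first exact/ltW/(hp N).2.
by rewrite mulrAC ler_wpM2r ?nrm_ge0.
Qed.

Lemma closed_span s : closed (span_seq s).
Proof.
elim: s => [|v s IH]; first by rewrite span_nilE; apply: closed_origin.
have -> : span_seq (v :: s) = [set z | exists a y, span_seq s y /\ z = a *: v + y].
  by apply/seteqP; split=> z /span_consP.
by apply: closed_add_line => //; apply: subspace_span.
Qed.

(* Coordinates are bounded by the norm, so moving the generators of a
   finite-dimensional space by [delta] moves its vectors by [O(delta)]. *)
Lemma span_perturb s : exists2 K : R, 0 < K &
  forall (g : X -> X) (delta : R), 0 <= delta ->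
  (forall v, v \in s -> nrm (v - g v) <= delta) ->
  forall x, span_seq s x -> exists2 y, span_seq (map g s) y & nrm (x - y) <= K * delta * nrm x.
Proof.
elim: s => [|v s [K K0 IH]].
  exists 1 => // g delta d0 _ x; rewrite span_nilE => ->; exists 0 => //.
  by rewrite subr0 !nrm0 mulr0.
have [vs|nvs] := pselect (span_seq s v).
  exists K => // g delta d0 hg x /span_consP[a [y [hy xE]]].
  have [|||z hz hxz] := IH g delta _ _ x; first by [].
  - by move=> w ws; apply: hg; rewrite inE ws orbT.
  - by rewrite xE; apply: (subspace_span s).2.
  by exists z => //; apply/span_consP; exists 0, z; rewrite scale0r add0r.
have [d d0 hd] := far_from_closed (@closed_span s) nvs.
(* As [v] is at distance at least [d] from the span of [s], its coefficient in [x] is at most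
   [|x| / d], and the remaining part of [x] has norm at most [(1 + |v| / d) |x|]. *)
exists (1 / d + K * (1 + nrm v / d)).
  have nv := nrm_ge0 v.
  by rewrite addr_gt0 ?divr_gt0// mulr_gt0// ltr_pwDl// divr_ge0// ltW.
move=> g delta delta0 hg x /span_consP[a [y [hy xE]]].
have ha : cabs a <= nrm x / d.
  by rewrite ler_pdivlMr// xE; apply: far_coef hy => //; apply: subspace_span.
have hny : nrm y <= (1 + nrm v / d) * nrm x.
  have -> : y = x - a *: v by rewrite xE addrAC subrr add0r.
  apply: le_trans (nrmB _ _) _; rewrite nrmZ mulrDl mul1r lerD2l.
  apply: le_trans (ler_wpM2r (nrm_ge0 v) ha) _.
  by rewrite le_eqVlt; apply/orP; left; apply/eqP; ring.
have [|||z hz hyz] := IH g delta _ _ y => //.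
  by move=> w ws; apply: hg; rewrite inE ws orbT.
exists (a *: g v + z); first by apply/span_consP; exists a, z.
have -> : x - (a *: g v + z) = a *: (v - g v) + (y - z).
  by rewrite xE opprD addrACA scalerBr.
apply: le_trans (nrmD _ _) _; rewrite nrmZ [X in _ <= X * _]mulrDl mulrDl; apply: lerD.
  have hv := hg v (mem_head _ _).
  apply: le_trans (ler_pM (cabs_ge0 _) (nrm_ge0 _) ha hv) _.
  by rewrite le_eqVlt; apply/orP; left; apply/eqP; ring.
apply: le_trans hyz _.
have -> : K * (1 + nrm v / d) * delta * nrm x = K * delta * ((1 + nrm v / d) * nrm x) by ring.
by apply: ler_wpM2l hny; rewrite mulr_ge0// ltW.
Qed.

(** The induction first absorbs [v] into [V]; the complement found for the larger space gets [v]
    back only when [v] is outside [V]. *)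
Lemma direct_complement s V Y : lin_subspace V ->
  (forall z, Y z -> exists b y, V b /\ span_seq s y /\ z = b + y) ->
  exists t, (forall z, Y z -> exists b y, V b /\ span_seq t y /\ z = b + y) /\
    (forall x, V x -> span_seq t x -> x = 0).
Proof.
elim: s V => [|v s IH] V sV h.
  by exists [::]; split=> // x _; rewrite span_nilE.
pose V' := [set z | exists a y, V y /\ z = a *: v + y].
have sV' : lin_subspace V'.
  split; first by exists 0, 0; rewrite scale0r addr0; split=> //; case: sV.
  move=> a _ _ [b [x [hx ->]]] [c [y [hy ->]]].
  exists (a * b + c), (a *: x + y); split; first exact: sV.2.
  by rewrite scalerDr addrACA scalerA scalerDl.
have [|t [ht1 ht2]] := IH V' sV'.
  move=> z /h[b [_ [Vb [/span_consP[a [y [hy ->]]] ->]]]].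
  by exists (a *: v + b), y; split; [exists a, b|rewrite addrA [b + _]addrC].
have [Vv|nVv] := pselect (V v).
  exists t; split=> [z /ht1[_ [y [[a [x [Vx ->]]] [hy ->]]]]|x Vx].
    by exists (a *: v + x), y; split=> //; apply: sV.2.
  by apply: ht2; exists 0, x; rewrite scale0r add0r.
exists (v :: t); split=> [z /ht1[_ [y [[a [x [Vx ->]]] [hy ->]]]]|x Vx].
  exists x, (a *: v + y); split=> //; split; first by apply/span_consP; exists a, y.
  by rewrite addrCA addrA.
move=> /span_consP[a [y [hy xE]]].
have y0 : y = 0.
  apply: ht2 => //; exists (- a), x; split=> //.
  by rewrite xE scaleNr addrA addNr add0r.
rewrite xE y0 addr0; have [->|a0] := eqVneq a 0; first by rewrite scale0r.
case: nVv; have -> : v = a^-1 *: x by rewrite xE y0 addr0 scalerA mulVf// scale1r.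
exact: subspaceZ.
Qed.

(** A finite-dimensional direct complement is closed, so [closed_image] applies to it. *)
Lemma closed_fin_codim B M Y :
  nrm_bounded B -> lin_subspace M -> closed M -> lin_subspace Y -> closed Y ->
  B @` M `<=` Y -> fin_codim_in (B @` M) Y -> closed (B @` M).
Proof.
move=> bB sM cM sY cY BMY [s hs].
have sBM : lin_subspace (B @` M) by apply: subspace_range => //; exact: bB.1.
have [t [ht1 ht2]] := direct_complement sBM hs.
apply: (closed_image (F := span_seq t) (Y := Y)) => //.
- exact: subspace_span.
- exact: closed_span.
- by move=> z /ht1[_ [y [[x Mx <-] [hy ->]]]]; exists x, y.
- by move=> x Mx hx; apply: ht2 => //; exists x.
Qed.

(** One vector of [V] outside the span of [s] suffices to eliminate the [v]-coordinate from all
    others, which leaves [V] intersected with that span. *)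
Lemma subspace_of_span s V : lin_subspace V -> V `<=` span_seq s ->
  exists2 t, (forall x, x \in t -> V x) & V `<=` span_seq t.
Proof.
elim: s V => [|v s IH] V sV h; first by exists [::].
have [||t ht1 ht2] := IH (V `&` span_seq s).
- by apply: subspaceI => //; apply: subspace_span.
- by move=> x [].
have [[x [Vx nx]]|H] := pselect (exists x, V x /\ ~ span_seq s x); last first.
  exists t; first by move=> x /ht1[].
  move=> x Vx; apply: ht2; split=> //; apply: contrapT => nx.
  by apply: H; exists x.
exists (x :: t); first by move=> y; rewrite inE => /orP[/eqP ->|/ht1[]].
have /span_consP[a [y [hy xE]]] := h _ Vx.
have a0 : a != 0.
  by apply/eqP => a0; apply: nx; rewrite xE a0 scale0r add0r.
move=> z Vz; have /span_consP[b [w [hw zE]]] := h _ Vz.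
apply/span_consP; exists (b / a), (z - (b / a) *: x); split; last by rewrite addrC subrK.
apply: ht2; split; first by apply: subspaceB => //; apply: subspaceZ.
have -> : z - (b / a) *: x = w - (b / a) *: y.
  rewrite zE xE scalerDr scalerA divfK// opprD !addrA.
  by rewrite [b *: v + w]addrC addrK.
by apply: subspaceB; [exact: subspace_span|by []|apply: subspaceZ => //; exact: subspace_span].
Qed.

(** Induction on the generators replaces counting dimensions. Either some [V k] falls into the span
    of [s], or every [V k] has a vector with nonzero [v]-coordinate, and subtracting a multiple of
    it reduces to the intersections with the span. *)
Lemma decreasing_stabilizes s (V : nat -> set X) :
  (forall k, lin_subspace (V k)) -> (forall k l, (k <= l)%N -> V l `<=` V k) ->
  V 0%N `<=` span_seq s -> exists m, forall k, (m <= k)%N -> V m `<=` V k.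
Proof.
elim: s V => [|v s IH] V sV dV h.
  by exists 0%N => k _ x /h; rewrite span_nilE => ->; case: (sV k).
have [[k0 hk0]|H] := pselect (exists k0, V k0 `<=` span_seq s).
  have [|||m hm] := IH (fun k => V (k0 + k)%N).
  - by [].
  - by move=> k l kl; apply: dV; rewrite leq_add2l.
  - by rewrite addn0.
  exists (k0 + m)%N => k hk; have := hm (k - k0)%N.
  rewrite subnKC; last exact: leq_trans (leq_addr _ _) hk.
  by apply; rewrite leq_subRL// (leq_trans (leq_addr _ _) hk).
have [|||m hm] := IH (fun k => V k `&` span_seq s).
- by move=> k; apply: subspaceI => //; apply: subspace_span.
- by move=> k l kl x [hx ?]; split=> //; apply: dV kl _ hx.
- by move=> x [].
exists m => k mk z Vz.
have [x [Vx nx]] : exists x, V k x /\ ~ span_seq s x.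
  apply: contrapT => h'; apply: H; exists k => x Vx.
  by apply: contrapT => nx; apply: h'; exists x.
have /span_consP[a [y [hy xE]]] := h _ (dV 0%N k (leq0n _) _ Vx).
have a0 : a != 0.
  by apply/eqP => a0; apply: nx; rewrite xE a0 scale0r add0r.
have /span_consP[b [w [hw zE]]] := h _ (dV 0%N m (leq0n _) _ Vz).
have [] // : (V k `&` span_seq s) (z - (b / a) *: x).
  apply: (hm _ mk); split.
    by apply: subspaceB => //; apply: subspaceZ => //; apply: dV mk _ Vx.
  have -> : z - (b / a) *: x = w - (b / a) *: y.
    rewrite zE xE scalerDr scalerA divfK// opprD !addrA.
    by rewrite [b *: v + w]addrC addrK.
  by apply: subspaceB; [exact: subspace_span|by []|apply: subspaceZ => //; exact: subspace_span].
move=> hV _; rewrite -[z](subrK ((b / a) *: x)); apply: subspaceD => //.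
exact: subspaceZ.
Qed.

Lemma span_map_linop S (h : X -> X) t : linear_op S ->
  (forall w, w \in t -> S (h w) = w) ->
  forall z, span_seq t z -> exists2 y, span_seq (map h t) y & S y = z.
Proof.
move=> lS; elim: t => [|v t IH] ht z.
  by rewrite span_nilE => ->; exists 0 => //; rewrite (linop0 lS).
move=> /span_consP[a [w [hw ->]]].
have [|y hy <-] := IH _ _ hw; first by move=> u ut; apply: ht; rewrite inE ut orbT.
exists (a *: h v + y); first by apply/span_consP; exists a, y.
by rewrite lS ht// mem_head.
Qed.

(** Generators of the kernel, together with preimages of generators of the part of [V] in the range,
    span the preimage. *)
Lemma fin_dim_preimage S V : linear_op S -> fin_dim (Defs.kernel S) ->
  lin_subspace V -> fin_dim V -> fin_dim (S @^-1` V).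
Proof.
move=> lS [s hs] sV [s' hs'].
have [||t ht1 ht2] := @subspace_of_span s' (V `&` range S).
- by apply: subspaceI => //; apply: subspace_range.
- by move=> x [/hs'].
have H w : exists u, range S w -> S u = w.
  have [[u _ hu]|nw] := pselect (range S w); first by exists u.
  by exists 0.
have [h hh] := choice H.
exists (s ++ map h t) => x Vx.
have [||y hy Sy] := @span_map_linop S h t lS _ (S x).
- by move=> w /ht1[_ /hh].
- by apply: ht2; split=> //; exists x.
rewrite -[x](subrK y); apply: subspaceD; first exact: subspace_span.
  by apply: span_catl; apply: hs; rewrite /Defs.kernel /= (linopB lS) Sy subrr.
exact: span_catr.
Qed.

(* Apply the hypothesis to [v - e], with [e] in [E] almost realizing the distance
   from [v] to [E]. *)
Lemma half_dense V (E : set X) : lin_subspace V -> lin_subspace E -> closed E -> E `<=` V ->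
  (forall v, V v -> exists2 e, E e & nrm (v - e) <= nrm v / 2) -> V `<=` E.
Proof.
move=> sV sE cE EV H v Vv; apply: contrapT => nE.
have [d0 d00 hd0] := far_from_closed cE nE.
pose D := [set nrm (v - e) | e in E].
have D0 : D !=set0 by exists (nrm (v - 0)); exists 0 => //; case: sE.
have lD : has_lbound D by exists d0 => _ [e Ee <-]; apply: hd0.
have d1 : d0 <= inf D by apply: lb_le_inf => // _ [e Ee <-]; apply: hd0.
(* The distance [inf D] is positive, so some [e] satisfies [nrm (v - e) < 2 * inf D]; halving then
   falls below the infimum. *)
have [|_ [e Ee <-] he] := @inf_adherent _ D (inf D) _ (conj D0 lD); first exact: lt_le_trans d1.
have [|e' Ee' he'] := H (v - e); first by apply: subspaceB => //; apply: EV.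
have : inf D <= nrm (v - e - e').
  apply: ge_inf => //; exists (e + e'); first exact: subspaceD.
  by rewrite opprD addrA.
lra.
Qed.
End FiniteDimension.

(** * Iterates, ascent and descent *)

Section Iterates.
Variables (R : realType) (X : completeNormedModType R[i]).
Implicit Types (x y z v : X) (a : R[i]) (S : X -> X) (s t : seq X).

Lemma range_iter_le S k l : (k <= l)%N -> range (iter l S) `<=` range (iter k S).
Proof.
by move=> kl _ [x _ <-]; exists (iter (l - k) S x) => //; rewrite -iterD subnKC.
Qed.

Lemma range_iterS S k : S @` range (iter k S) = range (iter k.+1 S).
Proof.
apply/seteqP; split=> [_ [_ [x _ <-] <-]|_ [x _ <-]]; first by exists x.
by exists (iter k S x) => //; exists x.
Qed.

Lemma subspace_range_iter S k : linear_op S -> lin_subspace (range (iter k S)).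
Proof. by move=> lS; apply: subspace_range => //; apply: linop_iter. Qed.

(** The same index serves both sides: equality of [N(S^n)] and [N(S^(n+1))] says that [S^n y]
    vanishes whenever [S] kills it. *)
Lemma finite_ascentP S : linear_op S ->
  finite_ascent S <-> exists m, forall x, S x = 0 -> range (iter m S) x -> x = 0.
Proof.
move=> lS; split=> [[n hn]|[m hm]]; [exists n|exists m].
  move=> x Sx [y _ xE]; suff : Defs.kernel (iter n S) y by rewrite -xE.
  by rewrite hn /Defs.kernel /= xE.
apply/seteqP; split=> x; rewrite /Defs.kernel /=; first by move=> ->; apply: linop0.
by move=> h; apply: hm => //; exists x.
Qed.

(** Kernels and ranges stay constant once they repeat. For [p] beyond both indices,
    [S^p x = S^(2p) y] for some [y], so [x - S^p y] lies in [N(S^p)]: this splits [X] into [R(S^p)]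
    and [N(S^p)]. *)
Lemma drazin_decomposition S : linear_op S -> finite_ascent S -> finite_descent S ->
  exists p, [/\ forall x, exists y z, iter p S z = 0 /\ x = iter p S y + z,
    forall y, iter p S (iter p S y) = 0 -> iter p S y = 0,
    forall x, range (iter p S) x -> S x = 0 -> x = 0 &
    range (iter p S) = range (iter p.+1 S)].
Proof.
move=> lS [n hn] [m hm].
have hker k : (n <= k)%N -> forall x, iter k.+1 S x = 0 -> iter k S x = 0.
  elim: k => [|k IH]; first by rewrite leqn0 => /eqP <- x h; suff: Defs.kernel (iter n S) x;
    [|rewrite hn].
  rewrite leq_eqVlt => /orP[/eqP <- x h|nk x]; last first.
    by rewrite iterSr [in X in _ -> X]iterSr; apply: IH.
  by suff: Defs.kernel (iter n S) x; [|rewrite hn].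
have hran k : (m <= k)%N -> range (iter k S) = range (iter k.+1 S).
  elim: k => [|k IH]; first by rewrite leqn0 => /eqP <-.
  rewrite leq_eqVlt => /orP[/eqP <- //|mk].
  by rewrite -(range_iterS S k) IH// range_iterS.
pose p := maxn n m; exists p.
have pn : (n <= p)%N by exact: leq_maxl.
have pm : (m <= p)%N by exact: leq_maxr.
have hker' j x : iter (p + j)%N S x = 0 -> iter p S x = 0.
  elim: j => [|j IH]; first by rewrite addn0.
  by rewrite addnS => h; apply/IH/hker => //; apply: leq_trans pn (leq_addr _ _).
have hran' j : range (iter p S) = range (iter (p + j)%N S).
  elim: j => [|j IH]; first by rewrite addn0.
  by rewrite addnS -hran//; apply: leq_trans pm (leq_addr _ _).
split.
- move=> x; have : range (iter p S) (iter p S x) by exists x.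
  rewrite (hran' p) => -[y _]; rewrite iterD => hy.
  exists y, (x - iter p S y); split; last by rewrite addrC subrK.
  by rewrite (linopB (linop_iter p lS)) hy subrr.
- by move=> y; rewrite -iterD; apply: hker'.
- by move=> _ [y _ <-] h; apply: hker.
- exact: hran.
Qed.

Lemma fin_dim_kernel_iter S k : linear_op S -> fin_dim (Defs.kernel S) ->
  fin_dim (Defs.kernel (iter k S)).
Proof.
move=> lS fS; elim: k => [|k IH].
  by exists [::]; rewrite span_nilE.
have -> : Defs.kernel (iter k.+1 S) = S @^-1` Defs.kernel (iter k S).
  by apply/seteqP; split=> x; rewrite /Defs.kernel /= -iterS iterSr.
by apply: fin_dim_preimage => //; apply: subspace_kernel; apply: linop_iter.
Qed.

(** [N(S^p)] is a closed complement of [R(S^p)], which makes the latter closed; on it [S] is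
    bijective, so empty lists of generators suffice. *)
Lemma drazin_B_fredholm S : nrm_bounded S -> finite_ascent S -> finite_descent S ->
  B_fredholm S.
Proof.
move=> bS aS dS; have lS := bS.1.
have [p [h1 h2 h3 h4]] := drazin_decomposition lS aS dS.
have bSp := nrm_bounded_iter p bS.
have cl : closed (range (iter p S)).
  apply: (closed_image (F := Defs.kernel (iter p S)) (Y := setT)) => //.
  - exact: (subspace_kernel bSp.1).
  - exact: closed_kernel.
  - by move=> x _; have [y [z [hz ->]]] := h1 x; exists y, z.
  - by move=> x _; apply: h2.
exists p => /=; rewrite range_iterS -h4; split=> //.
  by exists [::] => x [Sx rx]; rewrite span_nilE; apply: h3.
exists [::] => x rx; exists x, 0; split=> //; split; last by rewrite addr0.
by rewrite span_nilE.
Qed.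

(** [N(S^p)] is finite-dimensional along with [N(S)], and it complements [R(S^p)], which is
    contained in [R(S)]. *)
Lemma drazin_fredholm S : nrm_bounded S -> finite_ascent S -> finite_descent S ->
  fin_dim (Defs.kernel S) -> fredholm S.
Proof.
move=> bS aS dS fS; have lS := bS.1.
have [p [h1 _ _ h4]] := drazin_decomposition lS aS dS.
have fc : fin_codim_in (range S) setT.
  have [s hs] := fin_dim_kernel_iter p lS fS.
  exists s => x _; have [y [z [hz ->]]] := h1 x.
  exists (iter p S y), z; split; last by split=> //; apply: hs.
  (* Since [p] may be 0, the inclusion in [R(S)] goes through [R(S^(p+1))]. *)
  apply: (@range_iter_le S 1 p.+1) => //; rewrite -h4; by exists y.
by split=> //; apply: (closed_fin_codim (Y := setT)).
Qed.

Lemma fredholm_B_fredholm S : fredholm S -> B_fredholm S.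
Proof.
move=> [cS [fS cdS]]; exists 0%N => /=.
have -> : range (fun x : X => x) = setT by apply/seteqP; split=> x // _; exists x.
by rewrite setIT; split.
Qed.
End Iterates.

(** * B-Fredholm operators, the hyper-range and small shifts *)

Section BFredholm.
Variables (R : realType) (X : completeNormedModType R[i]).
Implicit Types (x y z v : X) (a : R[i]) (S : X -> X) (s t : seq X).

(** What a B-Fredholm operator satisfies for large [m]. By the second clause, [N(S)] intersected
    with [R(S^k)] no longer shrinks from [m] on. *)
Definition stable_index S m :=
  [/\ forall k, (m <= k)%N -> closed (range (iter k S)),
      forall k x, (m <= k)%N -> S x = 0 -> range (iter m S) x -> range (iter k S) x,
      fin_dim (Defs.kernel S `&` range (iter m S)) &
      fin_codim_in (range (iter m.+1 S)) (range (iter m S))].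

(** [S] maps vectors spanning [R(S^k)] modulo [R(S^(k+1))] to vectors spanning the next quotient, so
    finite codimension persists, and with it closedness. The finite-dimensional kernel parts
    decrease and therefore stabilise. *)
Lemma B_fredholm_stable_index S :
  nrm_bounded S -> B_fredholm S -> exists m, stable_index S m.
Proof.
move=> bS [n /= []]; have lS := bS.1; rewrite range_iterS => cM _ [s hs] fc.
have fck k : fin_codim_in (range (iter (n + k).+1 S)) (range (iter (n + k) S)).
  elim: k => [|k [t ht]]; first by rewrite addn0.
  exists (map S t); rewrite addnS -!range_iterS => _ [x hx <-].
  have [b [y [hb [hy ->]]]] := ht x hx.
  exists (S b), (S y); split; first by exists b => //; rewrite range_iterS.
  split; last exact: linopD.
  elim: t {ht} y hy => [|v t IH] y; first by rewrite /= span_nilE => ->; apply: linop0.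
  move=> /span_consP[a [w [hw ->]]]; apply/span_consP; exists a, (S w).
  by split; [apply: IH|apply: lS].
have cl k : closed (range (iter (n + k) S)).
  elim: k => [|k IH]; first by rewrite addn0.
  rewrite addnS -range_iterS; apply: (closed_fin_codim (Y := range (iter (n + k) S))) => //.
  - exact: subspace_range_iter.
  - exact: subspace_range_iter.
  - by rewrite range_iterS; apply: range_iter_le.
  - by rewrite range_iterS.
have [|||m hm] := @decreasing_stabilizes _ _ s (fun k => Defs.kernel S `&` range (iter (n + k) S)).
- by move=> k; apply: subspaceI; [apply: subspace_kernel|apply: subspace_range_iter].
- by move=> k l kl x [? h]; split=> //; apply: range_iter_le h; rewrite leq_add2l.
- by rewrite addn0.
exists (n + m)%N; split=> //.
- by move=> k hk; rewrite -(subnKC hk) -addnA.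
- move=> k x hk Sx hx; have mk : (m <= k - n)%N.
    by rewrite leq_subRL// (leq_trans (leq_addr _ _) hk).
  have [] // : (Defs.kernel S `&` range (iter (n + (k - n)) S)) x by apply: (hm _ mk).
  by rewrite subnKC// (leq_trans (leq_addr _ _) hk).
- by exists s => x [Sx hx]; apply: hs; split=> //; apply: range_iter_le hx; apply: leq_addr.
Qed.

Definition hyper_range S : set X := [set x | forall k, range (iter k S) x].

Lemma subspace_hyper_range S : linear_op S -> lin_subspace (hyper_range S).
Proof.
move=> lS; split=> [k|a x y hx hy k]; first by have [] := subspace_range_iter k lS.
by apply: (subspace_range_iter k lS).2.
Qed.

Lemma closed_hyper_range S m : stable_index S m -> closed (hyper_range S).
Proof.
move=> [cl _ _ _]; apply/closedP => x hx k.
(* Closedness is known from [m] on, so the limit is taken in the smaller range at [maxn m k]. *)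
apply: (@range_iter_le _ _ _ k (maxn m k)); first exact: leq_maxr.
move/closedP: (cl _ (leq_maxl m k)); apply=> e /hx[y hy h]; by exists y.
Qed.

Lemma kernel_hyper_range S m x : stable_index S m ->
  S x = 0 -> range (iter m S) x -> hyper_range S x.
Proof.
move=> [_ h _ _] Sx hx k; apply: (@range_iter_le _ _ _ k (maxn m k)); first exact: leq_maxr.
by apply: h => //; apply: leq_maxl.
Qed.

(* A preimage [x] of [z] in R(S^m) differs from a preimage in R(S^k) by an element of
   N(S) and R(S^m), which lies in every R(S^k) by the choice of [m]. *)
Lemma hyper_range_onto S m z : linear_op S -> stable_index S m -> hyper_range S z ->
  exists2 x, hyper_range S x & S x = z.
Proof.
move=> lS sm hz.
have hr k : exists2 x, range (iter k S) x & S x = z.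
  by have := hz k.+1; rewrite -range_iterS => -[x hx <-]; exists x.
have [x hx Sx] := hr m; exists x => // k.
apply: (@range_iter_le _ _ _ k (maxn m k)); first exact: leq_maxr.
have [y hy Sy] := hr (maxn m k).
rewrite -[x](subrK y); apply: subspaceD => //; first exact: subspace_range_iter.
apply: (kernel_hyper_range sm); first by rewrite (linopB lS) Sx Sy subrr.
apply: subspaceB => //; first exact: subspace_range_iter.
exact: range_iter_le (leq_maxl _ _) _ hy.
Qed.

Lemma hyper_range_open S m : nrm_bounded S -> stable_index S m ->
  exists2 c : R, 0 < c & open_onto S (hyper_range S) [set 0] (hyper_range S) c.
Proof.
move=> bS sm; have lS := bS.1; apply: open_mapping => //.
- exact: subspace_hyper_range.
- exact: closed_hyper_range sm.
- exact: subspace1.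
- exact: closed_origin.
- exact: subspace_hyper_range.
- exact: closed_hyper_range sm.
- move=> z /(hyper_range_onto lS sm)[x hx <-]; exists x, 0; split=> //.
  by rewrite addr0.
Qed.

(** Since [x] is [a^-1] times [S x - (S - a) x], membership of [x] in [R(S^j)] improves to
    [R(S^(j+1))] as long as [j < k]. *)
Lemma shift_range_iter S a k x : linear_op S -> a != 0 ->
  range (iter k S) (shift_op S a x) -> range (iter k S) x.
Proof.
move=> lS a0 hz.
suff H j : (j <= k)%N -> range (iter j S) x by apply: H.
elim: j => [|j IH] jk; first by exists x.
have -> : x = a^-1 *: (S x - shift_op S a x).
  by rewrite /shift_op opprB addrC subrK scalerA mulVf// scale1r.
have sR := subspace_range_iter j.+1 lS.
apply: subspaceZ => //; apply: subspaceB => //; last exact: range_iter_le jk _ hz.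
by have [u _ <-] := IH (ltnW jk); exists u.
Qed.

Lemma shift_kernel_hyper_range S a x : linear_op S -> a != 0 ->
  shift_op S a x = 0 -> hyper_range S x.
Proof.
move=> lS a0 h k; apply: (shift_range_iter lS a0); rewrite h.
by have [] := subspace_range_iter k lS.
Qed.

(** The polynomials [t^k] and [t - a] are coprime; concretely, [u = a^-1 (S u - (S - a) u)] raises
    the exponent by one at each step. *)
Lemma shift_range_add S a k x : linear_op S -> a != 0 ->
  exists u w, x = iter k S u + shift_op S a w.
Proof.
move=> lS a0; elim: k => [|k [u [w ->]]].
  by exists x, 0; rewrite (linop0 (linop_shift a lS)) addr0.
exists (a^-1 *: u), (w - a^-1 *: iter k S u).
have lSa := linop_shift a lS; rewrite (linopB lSa) [RHS]addrCA [LHS]addrC; congr (_ + _).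
rewrite (linopZ lSa) (linopZ (linop_iter k.+1 lS)) -scalerBr /=.
by rewrite /shift_op opprB addrC subrK scalerA mulVf// scale1r.
Qed.

(** Finitely many vectors [s] span [R(S^m)] modulo [R(S^(m+1))], so [(x, f) |-> S x + f] is open
    onto [R(S^m)], and so it remains for [S - a]. As [X = R(S^m) + R(S - a)], the same [s] span [X]
    modulo [R(S - a)]. *)
Lemma fin_codim_shift S m : nrm_bounded S -> stable_index S m ->
  exists2 d : R, 0 < d & forall a, a != 0 -> cabs a <= d ->
  fin_codim_in (range (shift_op S a)) setT.
Proof.
move=> bS [cl _ _ [s hs]]; have lS := bS.1.
have sR := subspace_range_iter m lS.
have cR : closed (range (iter m S)) by exact: cl.
have [c c0 hc] : exists2 c : R, 0 < c &
    open_onto S (range (iter m S)) (span_seq s) (range (iter m S)) c.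
  apply: open_mapping => //; [exact: subspace_span|exact: closed_span|].
  move=> z /hs[b [y [hb [hy ->]]]]; move: hb; rewrite -range_iterS => -[x hx <-].
  by exists x, y.
exists (1 / 2 / c); first by rewrite !divr_gt0.
move=> a a0 ha; exists s => x _.
have [u [w ->]] := shift_range_add m x lS a0.
have hc' : open_onto (shift_op S a) (range (iter m S)) (span_seq s) (range (iter m S)) (2 * c).
  apply: open_onto_shift => //; [exact: subspace_span|exact: closed_span|exact: ltW|].
  by rewrite -ler_pdivlMr.
have [|x' [f [_ Ff E _ _]]] := hc' (iter m S u); first by exists u.
exists (shift_op S a (x' + w)), f; split; first by exists (x' + w).
by split=> //; rewrite (linopD (linop_shift a lS)) E addrAC.
Qed.

(** The generators [t] of the part [N] of [N(S)] in the hyper-range are moved slightly into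
    [N(S - a)]. Conversely, a vector of [N(S - a)] is close to [N], hence to the span of the moved
    generators, and [half_dense] turns closeness into membership. *)
Lemma fin_dim_kernel_shift S m : nrm_bounded S -> stable_index S m ->
  exists2 d : R, 0 < d & forall a, a != 0 -> cabs a <= d ->
  fin_dim (Defs.kernel (shift_op S a)).
Proof.
move=> bS sm; have lS := bS.1.
have sH := subspace_hyper_range lS; have cH := closed_hyper_range sm.
have [c c0 hc] := hyper_range_open bS sm.
pose N := Defs.kernel S `&` hyper_range S.
have sN : lin_subspace N by apply: subspaceI => //; apply: subspace_kernel.
have [s hs] : fin_dim N.
  have [_ _ [s hs] _] := sm; exists s => x [Sx hx]; apply: hs; split=> //; exact: hx.
have [t ht1 ht2] := subspace_of_span sN hs.
have [K K0 hK] := span_perturb t.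
pose T : R := \sum_(v <- t) nrm v.
have T0 : 0 <= T by apply: sumr_ge0 => v _; apply: nrm_ge0.
have hT v : v \in t -> nrm v <= T.
  move=> vt; rewrite /T (big_rem v)//= lerDl; apply: sumr_ge0 => w _; exact: nrm_ge0.
(* The first summand keeps the distance from [v] to [N] within [|v| / 4]; the second does the same
   for the error caused by moving the generators. *)
pose D : R := 4 * c + 16 * K * c * T.
have KcT : 0 <= K * c * T by rewrite !mulr_ge0// ltW.
have D0 : 0 < D by rewrite /D -!mulrA; lra.
exists (1 / D); first by rewrite divr_gt0.
move=> a a0; rewrite ler_pdivlMr// => ha.
have a1 := cabs_ge0 a.
have aD1 : cabs a * (4 * c) <= 1.
  by apply: le_trans ha; rewrite ler_wpM2l// lerDl -!mulrA; lra.
have aD2 : cabs a * (16 * K * c * T) <= 1.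
  by apply: le_trans ha; rewrite ler_wpM2l// lerDr; lra.
have hc' : open_onto (shift_op S a) (hyper_range S) [set 0] (hyper_range S) (2 * c).
  apply: open_onto_shift => //; [exact: subspace1|exact: closed_origin|exact: ltW|lra].
have lSa := linop_shift a lS.
have Hg v : exists w, N v -> shift_op S a w = 0 /\ nrm (v - w) <= 2 * c * cabs a * nrm v.
  have [[Sv hv]|nN] := pselect (N v); last by exists 0.
  (* For [v] in [N], [(S - a) v = - a v]; a small [y] solving the same equation makes [v - y] a
     kernel vector of [S - a]. *)
  have [|y [f [hy /= -> E hn _]]] := hc' (- a *: v); first exact: (subspaceZ _ sH).
  exists (v - y) => _; rewrite (linopB lSa); split.
    by move: E; rewrite addr0 => <-; rewrite /shift_op Sv sub0r scaleNr subrr.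
  rewrite opprB addrC subrK; apply: le_trans hn _.
  by rewrite nrmZ cabsN mulrA.
have [g hg] := choice Hg.
exists (map g t); apply: half_dense.
- exact: subspace_kernel.
- exact: subspace_span.
- exact: closed_span.
- apply: span_seq_sub; first exact: subspace_kernel.
  by move=> _ /mapP[v vt ->]; have [] := hg v (ht1 v vt).
move=> v kv; have hv : hyper_range S v := shift_kernel_hyper_range lS a0 kv.
have Sv : S v = a *: v by apply/eqP; rewrite -subr_eq0; apply/eqP.
(* Here [y] is a small solution of [S y = S v], so that [v - y] lies in [N]. *)
have [|y [f [hy /= -> E hn _]]] := hc (a *: v); first exact: (subspaceZ _ sH).
rewrite addr0 in E; rewrite nrmZ in hn.
have Nn : N (v - y).
  by split; [rewrite /Defs.kernel /= (linopB lS) Sv -E subrr|exact: (subspaceB sH)].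
have [|w ww|e he hne] := hK g (2 * c * cabs a * T) _ _ _ (ht2 _ Nn).
- by rewrite !mulr_ge0// ltW.
- have [_ h] := hg w (ht1 w ww); apply: le_trans h _.
  by rewrite ler_wpM2l ?hT// !mulr_ge0// ltW.
exists e => //.
have -> : v - e = y + (v - y - e) by rewrite addrA addrCA subrr addr0.
apply: le_trans (nrmD _ _) _.
have nv := nrm_ge0 v.
have hy' : nrm y <= nrm v / 4.
  have : 0 <= nrm v * (1 - cabs a * (4 * c)) by rewrite mulr_ge0// subr_ge0.
  move: hn; lra.
have hn2 : nrm (v - y) <= 2 * nrm v by have := nrmB v y; lra.
have hq : 0 <= K * (2 * c * cabs a * T) by rewrite !mulr_ge0// ltW.
have := ler_wpM2l hq hn2.
have : 0 <= nrm v * (1 - cabs a * (16 * K * c * T)) by rewrite mulr_ge0// subr_ge0.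
lra.
Qed.

Lemma fredholm_shift S m : nrm_bounded S -> stable_index S m ->
  exists2 d : R, 0 < d & forall a, a != 0 -> cabs a <= d -> fredholm (shift_op S a).
Proof.
move=> bS sm.
have [d1 d10 h1] := fin_codim_shift bS sm; have [d2 d20 h2] := fin_dim_kernel_shift bS sm.
exists (Num.min d1 d2); first by rewrite lt_min d10.
move=> a a0; rewrite le_min => /andP[ad1 ad2].
have fc := h1 a a0 ad1; split; last by split=> //; apply: h2.
apply: (closed_fin_codim (Y := setT)) => //.
exact: nrm_bounded_shift.
Qed.

Lemma small_scalar (d1 d2 : R) : 0 < d1 -> 0 < d2 ->
  exists a : R[i], [/\ a != 0, cabs a <= d1 & cabs a <= d2].
Proof.
move=> d10 d20; have m0 : 0 < Num.min d1 d2 by rewrite lt_min d10.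
exists (Num.min d1 d2)%:C%C; rewrite cabs_real ?(ltW m0)// !ge_min !lexx orbT; split=> //.
by apply/eqP => /complexI /eqP; rewrite gt_eqF.
Qed.

(* [S - a] maps the hyper-range onto itself. If [x <> 0] were a kernel vector of [S] in
   it, solving [(S - a) y = (S - a) x] with [y] smaller than [x] would give a nonzero
   kernel vector [x - y] of [S - a] in the range of every power of [S - a]. *)
Lemma stable_index_ascent S m : nrm_bounded S -> stable_index S m ->
  (forall a, a != 0 -> fredholm (shift_op S a) -> finite_ascent (shift_op S a)) ->
  forall x, S x = 0 -> range (iter m S) x -> x = 0.
Proof.
move=> bS sm H x Sx /(kernel_hyper_range sm Sx) hx; have lS := bS.1.
have sH := subspace_hyper_range lS; have cH := closed_hyper_range sm.
have [c c0 hc] := hyper_range_open bS sm; have [d d0 hd] := fredholm_shift bS sm.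
(* The bound [cabs a * c <= 1 / 4] is within the [1 / 2] required for openness of [S - a], and it
   makes [y] at most half as large as [x]. *)
have [||a [a0 ad ac]] := @small_scalar d (1 / 4 / c) => //; first by rewrite !divr_gt0.
rewrite ler_pdivlMr// in ac.
have lSa := linop_shift a lS.
have hc' : open_onto (shift_op S a) (hyper_range S) [set 0] (hyper_range S) (2 * c).
  apply: open_onto_shift => //; [exact: subspace1|exact: closed_origin|exact: ltW|lra].
have hr k z : hyper_range S z -> range (iter k (shift_op S a)) z.
  elim: k z => [|k IH] z hz; first by exists z.
  have [y [f [hy /= -> -> _ _]]] := hc' z hz.
  by rewrite addr0; have [u _ <-] := IH y hy; exists u.
have /(finite_ascentP lSa)[p hp] := H a a0 (hd a a0 ad).
have [|y [f [hy /= -> E hn _]]] := hc' (- a *: x); first exact: (subspaceZ _ sH).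
have xy : x - y = 0.
  apply: hp; last by apply: hr; exact: (subspaceB sH).
  by rewrite (linopB lSa); move: E; rewrite addr0 => <-; rewrite /shift_op Sx sub0r scaleNr subrr.
apply/nrm_eq0; move/eqP: xy; rewrite subr_eq0 => /eqP xy.
rewrite -xy nrmZ cabsN in hn; have nx := nrm_ge0 x.
have : 0 <= nrm x * (1 / 4 - cabs a * c) by rewrite mulr_ge0// subr_ge0.
lra.
Qed.

(* [S] is bounded below on R(S^m), hence [S - a] is injective; finite descent makes it
   bijective with an inverse bounded uniformly in [a], so [S = (S - a) + a] is still onto. *)
Lemma stable_index_descent S m : nrm_bounded S -> stable_index S m ->
  (forall x, S x = 0 -> range (iter m S) x -> x = 0) ->
  (forall a, a != 0 -> fredholm (shift_op S a) -> finite_descent (shift_op S a)) ->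
  range (iter m S) = range (iter m.+1 S).
Proof.
move=> bS sm inj H; have lS := bS.1; have [cl _ _ _] := sm.
set M := range (iter m S); have sM : lin_subspace M by exact: subspace_range_iter.
have cM : closed M by exact: cl.
have [c c0 hc] : exists2 c : R, 0 < c & open_onto S M [set 0] (range (iter m.+1 S)) c.
  apply: open_mapping => //; [exact: subspace1|exact: closed_origin|
    exact: subspace_range_iter|exact: cl|].
  move=> _ [u _ <-]; exists (iter m S u), 0; rewrite addr0; split=> //; by exists u.
have below x : M x -> nrm x <= c * nrm (S x).
  move=> Mx; have [|y [f [My /= -> E hy _]]] := hc (S x).
    by rewrite -range_iterS; exists x.
  suff xy : x = y by rewrite {1}xy.
  apply/eqP; rewrite -subr_eq0; apply/eqP/inj; last exact: (subspaceB sM).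
  by rewrite (linopB lS) E addr0 subrr.
have [d d0 hd] := fredholm_shift bS sm.
have [||a [a0 ad ac]] := @small_scalar d (1 / 4 / c) => //; first by rewrite !divr_gt0.
rewrite ler_pdivlMr// in ac.
have lSa := linop_shift a lS.
(* The perturbation contributes at most [nrm x / 4], which is absorbed on the left at the cost of
   doubling [c]. *)
have below' x : M x -> nrm x <= 2 * c * nrm (shift_op S a x).
  move=> Mx; have := below x Mx.
  have : nrm (S x) <= nrm (shift_op S a x) + cabs a * nrm x.
    by rewrite -nrmZ -[S x](subrK (a *: x)); apply: nrmD.
  move=> /(ler_wpM2l (ltW c0)); rewrite mulrDr => h1 h2; have nx := nrm_ge0 x.
  have : 0 <= nrm x * (1 / 4 - cabs a * c) by rewrite mulr_ge0// subr_ge0.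
  have := mulr_ge0 (ltW c0) (nrm_ge0 (shift_op S a x)).
  lra.
have injSa x : shift_op S a x = 0 -> x = 0.
  move=> h; have /below' : M x by apply: (shift_kernel_hyper_range lS a0 h).
  rewrite h nrm0 mulr0 => hx; apply: nrm_eq0; apply/eqP; by rewrite eq_le hx nrm_ge0.
have [p hp] := H a a0 (hd a a0 ad).
(* Finite descent gives [(S - a)^p z = (S - a)^(p+1) x], and injectivity cancels the [p]-th
   power. *)
have surj z : exists x, shift_op S a x = z.
  have : range (iter p (shift_op S a)) (iter p (shift_op S a) z) by exists z.
  rewrite hp => -[x _]; rewrite iterSr => hx; exists x.
  have injk k u : iter k (shift_op S a) u = 0 -> u = 0.
    by elim: k => // k IH /= /injSa.
  apply/eqP; rewrite -subr_eq0; apply/eqP/(injk p).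
  by rewrite (linopB (linop_iter p lSa)) hx subrr.
have hop : open_onto (shift_op S a) M [set 0] M (2 * c).
  move=> z Mz; have [x hx] := surj z.
  have Mx : M x by apply: (shift_range_iter lS a0); rewrite hx.
  exists x, 0; rewrite addr0 nrm0 -hx; split=> //; first exact: below'.
  by rewrite mulr_ge0 ?nrm_ge0// mulr_ge0// ltW.
(* Shifting by [- a] restores [S]; as the constant [2 * c] does not depend on [a],
   [cabs a * c <= 1 / 4] suffices. *)
have hop' : open_onto (shift_op (shift_op S a) (- a)) M [set 0] M (2 * (2 * c)).
  apply: open_onto_shift => //.
  - exact: nrm_bounded_shift.
  - exact: subspace1.
  - exact: closed_origin.
  - by rewrite mulr_ge0// ltW.
  - by rewrite cabsN; lra.
apply/seteqP; split; last exact: range_iter_le.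
move=> z /hop'[x [f [[u _ uE] /= -> -> _ _]]]; exists u => //.
by rewrite /= uE addr0 /shift_op scaleNr opprK subrK.
Qed.
End BFredholm.

(** * Equivalence of the two spectral classes *)

Theorem theorem2p4 (R : realType) (X : completeNormedModType R[i]) (T : X -> X)
  (hinf : ~ fin_dim (setT : set X)) (hT : bounded_op T) :
  class_Be T <-> class_gBe T.
Proof.
have bT l : nrm_bounded (shift_op T l) by apply/nrm_bounded_shift/bounded_op_nrm.
split=> hB; apply/seteqP; split=> l.
- move=> [sl /contrapT bf]; split=> //.
  have [m sm] := B_fredholm_stable_index (bT l) bf.
  (* A Fredholm point [l + a] in the spectrum is a pole by [(B_e)]; outside the spectrum,
     bijectivity gives ascent and descent 0. *)
  have H a : a != 0 -> fredholm (shift_op (shift_op T l) a) ->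
      finite_ascent (shift_op (shift_op T l) a) /\ finite_descent (shift_op (shift_op T l) a).
    have -> : shift_op (shift_op T l) a = shift_op T (l + a).
      by apply/funext => x; rewrite /shift_op scalerDl opprD addrA.
    move=> _ fr; have [sp|/contrapT[S' [_ [h1 h2]]]] := pselect (Defs.spectrum T (l + a)).
      by have [[_ ?] _] : poles0 T (l + a) by rewrite -hB; split=> // /(_ fr).
    split; exists 0%N; apply/seteqP; split=> x.
    - by rewrite /Defs.kernel /= => ->; apply: linop0; exact: (bT _).1.
    - rewrite /Defs.kernel /= => h; rewrite -(h1 x) h.
      by rewrite -{1}(linop0 (bT (l + a)).1) h1.
    - by move=> _; exists (S' x) => //=; rewrite h2.
    - by move=> _; exists x.
  have asc := stable_index_ascent (bT l) sm (fun a a0 fr => (H a a0 fr).1).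
  split; first by apply/(finite_ascentP (bT l).1); exists m.
  by exists m; apply: stable_index_descent (bT l) sm asc (fun a a0 fr => (H a a0 fr).2).
- move=> [sl [al dl]]; split=> // nbf; apply: nbf; exact: drazin_B_fredholm.
(* A Fredholm point of the spectrum is B-Fredholm, hence a pole by [(gB_e)]; its kernel is
   finite-dimensional by Fredholmness. *)
- move=> [sl /contrapT fr]; split; last by have [_ []] := fr.
  by rewrite -hB; split=> // nbf; apply: nbf; apply: fredholm_B_fredholm.
- move=> [[sl [al dl]] fk]; split=> // nfr; apply: nfr; exact: drazin_fredholm.
Qed.
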